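(* Let $k\ge 1$, let $a_1,\ldots,a_k$ be nonnegative integers and let $S\subseteq\{1,\ldots,k\}$. Let $l_i=1$ if $i\notin S$ and let $l_i=a_i$ if $i\in S$. The number of $(a_1,\ldots,a_k,S)$-derangements is $$\sum_{\substack{0\le b_m\le l_m\\ m=1,\ldots,k}} (-1)^{\sum_{i=1}^k b_i}\binom{\sum_{i=1}^k (a_i-b_i)}{a_1-b_1,\ldots,a_k-b_k},$$ where the sum is over all $k$-tuples of integers $(b_1,\ldots,b_k)$ with $0\le b_m\le l_m$ for every $m$.
   Context: Let $n=a_1+\cdots+a_k$ and partition $\{1,\ldots,n\}$ into consecutive blocks $A_1,\ldots,A_k$ (in this order) with $|A_i|=a_i$, i.e. $A_i=\{a_1+\cdots+a_{i-1}+1,\ldots,a_1+\cdots+a_i\}$ (blocks may be empty). An $(a_1,\ldots,a_k,S)$-permutation is a permutation $\pi$ of $\{1,\ldots,n\}$ that descends within each block $A_i$ with $i\in S$ (that is, $\pi(j)>\pi(j+1)$ whenever $j,j+1\in A_i$) and ascends within each block $A_i$ with $i\notin S$ (that is, $\pi(j)<\pi(j+1)$ whenever $j,j+1\in A_i$); no condition is imposed between different blocks. An $(a_1,\ldots,a_k,S)$-derangement is an $(a_1,\ldots,a_k,S)$-permutation with no fixed points, i.e. no $j$ with $\pi(j)=j$. For $n=0$ the unique (empty) permutation counts as a derangement. The symbol $\binom{N}{c_1,\ldots,c_k}$ with $N=c_1+\cdots+c_k$ is the multinomial coefficient $\frac{N!}{c_1!\cdots c_k!}$, interpreted as $0$ if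 some $c_i$ is negative. *)

(* Defs.v *)
From mathcomp Require Import all_boot all_order all_fingroup all_algebra.

Set Implicit Arguments.
Unset Strict Implicit.
Unset Printing Implicit Defensive.

Import Order.TTheory GRing.Theory Num.Theory.

(* Positions and values are counted from 0: the ordinal [j : 'I_n] stands for
   the element [j + 1] of {1, ..., n}.  Both sides of a permutation are shifted
   alike, so fixed points, ascents and descents are unaffected. *)

Definition total (k : nat) (a : 'I_k -> nat) : nat := \sum_i a i.

Definition block (k : nat) (a : 'I_k -> nat) (i : 'I_k) : {set 'I_(total a)} :=
  [set j : 'I_(total a) |
     \sum_(m < k | m < i) a m <= j < \sum_(m < k | m <= i) a m].

Definition blockwise_monotone (k : nat) (a : 'I_k -> nat) (S : {set 'I_k})
    (p : 'S_(total a)) : bool :=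
  [forall i : 'I_k, forall j in block a i, forall j' in block a i,
     (j' == j.+1 :> nat) ==> (if i \in S then p j' < p j else p j < p j')].

Definition derangement (n : nat) (p : 'S_n) : bool := [forall j, p j != j].

Definition aS_derangements (k : nat) (a : 'I_k -> nat) (S : {set 'I_k}) :
    {set 'S_(total a)} :=
  [set p | blockwise_monotone S p && derangement p].

Definition bmax (k : nat) (a : 'I_k -> nat) (S : {set 'I_k}) (i : 'I_k) : nat :=
  if i \in S then a i else 1.

Local Open Scope ring_scope.

(* The quotient of factorials is exact, so truncated division loses nothing. *)
Definition multinomial (k : nat) (c : 'I_k -> int) : int :=
  if [forall i, 0 <= c i]
  then Posz ((absz (\sum_i c i)%R)`! %/ \prod_i (absz (c i))`!)%N
  else 0.

(* Main.v *)
Require Import Defs.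
From mathcomp Require Import all_boot all_order all_fingroup all_algebra.
From mathcomp Require Import zify ring.

Set Implicit Arguments.
Unset Strict Implicit.
Unset Printing Implicit Defensive.

Import Order.TTheory GRing.Theory Num.Theory.

(** Proof idea.  Read a blockwise monotone permutation p backwards: write under
    each value v the block that contains the position of v.  The resulting word
    w over the alphabet of blocks has a_i letters i, and it determines p,
    because within a block the positions are filled in the order of the values
    (or in the opposite order, if the block descends).  So p is counted by its
    word, the total number of words is a multinomial coefficient
    ([size_words]), and a fixed point of p is a letter of w whose index equals
    the position it encodes; this is a condition on the letters to its left
    and to its right only, the predicate [fixed].

    The heart of the matter is what happens when one fixed point is deleted, in
    the word language when a fixed letter i is erased.  Every other letter keeps
    its status ([fixed_del_after], [fixed_del_before]): the index and the
    position of a letter both drop by one, or both stay, unless the letter is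
    an excedance or a deficiency so large that it remains one.  For the
    letters i themselves, look at the difference between index and position as
    the index grows.

    - If the block descends, the difference is strictly monotone.  Hence there
      is at most one fixed i, and a word with no fixed i has exactly one place
      where a fixed i can be inserted.
    - If the block ascends, the difference is weakly monotone.  Hence the fixed
      letters i are adjacent in the word, erasing any of them gives the same
      result, and every word has, up to equality of the result, exactly one way
      of inserting a fixed i.

    Let D_T(a) be the number of words of content a with no fixed letter from
    the set T of blocks.  For i outside T, the words counted by D_T(a) which do
    have a fixed i therefore correspond to those counted by D_T(a - e_i) if
    block i ascends, and by D_(i |: T)(a - e_i) if it descends
    ([fixfree_countU1]):

      D_(i |: T)(a) = D_T(a) - D_T(a - e_i)            in the first case,
      D_(i |: T)(a) = D_T(a) - D_(i |: T)(a - e_i)     in the second.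

    Unfolding the second recurrence expresses D_(i |: T)(a) as the alternating
    sum of D_T(a - c e_i) over 0 <= c <= l_i, in both cases
    ([fixfree_countU1_sum]).  Adding the blocks to T one at a time, starting
    from the empty set, where D is the multinomial coefficient, produces the
    sum over all tuples b ([fixfree_count_sum]). *)

(** * Comparing lists along a relation *)

Lemma leq_size_injrel (X Y : eqType) (R : X -> Y -> Prop) (xs : seq X) (ys : seq Y) :
  uniq xs -> (forall x, x \in xs -> exists2 y, y \in ys & R x y) ->
  (forall x x' y, x \in xs -> x' \in xs -> y \in ys -> R x y -> R x' y -> x = x') ->
  size xs <= size ys.
Proof.
elim: xs ys => [|x xs IH] ys //= /andP[xNxs xs_uniq] tot inj.
have [y y_ys Rxy] := tot x (mem_head x xs).
have /perm_size -> /= := perm_to_rem y_ys; rewrite ltnS.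
have sub_xs z : z \in xs -> z \in x :: xs by rewrite inE => ->; rewrite orbT.
apply: IH => // [x' x'_xs | x1 x2 y' /sub_xs ? /sub_xs ? /mem_rem ?]; last exact: inj.
have [y' y'_ys Rx'y'] := tot x' (sub_xs _ x'_xs).
exists y' => //; have := y'_ys; rewrite (perm_mem (perm_to_rem y_ys)) inE.
case/predU1P=> // y'y; rewrite y'y in Rx'y'.
by move: xNxs; rewrite -(inj x' x y) // ?mem_head ?sub_xs // x'_xs.
Qed.

(** Bijections below are given as relations (erase a letter, read a word off a
    permutation) that are total and injective on both sides; no inverse function
    has to be written down. *)
Lemma eq_size_birel (X Y : eqType) (R : X -> Y -> Prop) (xs : seq X) (ys : seq Y) :
  uniq xs -> uniq ys ->
  (forall x, x \in xs -> exists2 y, y \in ys & R x y) ->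
  (forall y, y \in ys -> exists2 x, x \in xs & R x y) ->
  (forall x x' y, x \in xs -> x' \in xs -> y \in ys -> R x y -> R x' y -> x = x') ->
  (forall x y y', x \in xs -> y \in ys -> y' \in ys -> R x y -> R x y' -> y = y') ->
  size xs = size ys.
Proof.
move=> xs_uniq ys_uniq totx toty injx injy; apply/eqP; rewrite eqn_leq.
rewrite (leq_size_injrel (R := R)) //=.
by apply: (leq_size_injrel (R := fun y x => R x y)) => // y y' x *; apply: (injy x).
Qed.

(** * Sequences and ordinals *)

Lemma all_pred1_cat_cons (T : eqType) (i : T) s t :
  all (pred1 i) s -> s ++ i :: t = i :: s ++ t.
Proof. by elim: s => //= x s IH /andP[/eqP-> /IH->]. Qed.

Lemma cat_eq_cat T (s1 s2 t1 t2 : seq T) : s1 ++ t1 = s2 ++ t2 ->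
  (exists r, s2 = s1 ++ r /\ t1 = r ++ t2) \/ (exists r, s1 = s2 ++ r /\ t2 = r ++ t1).
Proof.
elim: s1 s2 => [|x s1 IH] [|y s2] /=.
- by move->; left; exists [::].
- by move->; left; exists (y :: s2).
- by move=> <-; right; exists (x :: s1).
by case=> -> /IH[[r [-> ->]]|[r [-> ->]]]; [left | right]; exists r.
Qed.

Lemma cat_cons_eq_cat T (s1 s2 t1 : seq T) i t2 : s1 ++ t1 = s2 ++ i :: t2 ->
  (exists r, s1 = s2 ++ i :: r /\ t2 = r ++ t1) \/
  (exists r, s2 = s1 ++ r /\ t1 = r ++ i :: t2).
Proof.
elim: s1 s2 => [|x s1 IH] [|y s2] /=.
- by move->; right; exists [::].
- by move->; right; exists (y :: s2).
- by case=> -> <-; left; exists s1.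
by case=> -> /IH[[r [-> ->]]|[r [-> ->]]]; [left | right]; exists r.
Qed.

Lemma card_ord_ltn n m : m <= n -> #|[set j : 'I_n | j < m]| = m.
Proof.
move=> mn; rewrite -sum1_card; under eq_bigl do rewrite inE.
by rewrite (big_ord_narrow mn) sum1_card card_ord.
Qed.

Lemma enum_ord_split n (v : 'I_n) : exists e1 e2,
  [/\ enum 'I_n = e1 ++ v :: e2, size e1 = v, {in e1, forall u : 'I_n, u < v}
    & {in e2, forall u : 'I_n, v < u}].
Proof.
exists (take v (enum 'I_n)), (drop v.+1 (enum 'I_n)).
have vn : v < size (enum 'I_n) by rewrite size_enum_ord.
have E : enum 'I_n = take v (enum 'I_n) ++ v :: drop v.+1 (enum 'I_n).
  by rewrite -{1}[enum _](cat_take_drop v) (drop_nth v vn) nth_ord_enum.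
have : pairwise (fun u u' : 'I_n => u < u') (enum 'I_n).
  rewrite -(pairwise_map val ltn) val_enum_ord -sorted_pairwise ?iota_ltn_sorted //.
  exact: ltn_trans.
rewrite [X in pairwise _ X]E pairwise_cat /= allrel_consr.
case/and4P=> /andP[/allP l1 _] _ /allP l2 _.
split=> //; rewrite size_takel // ltnW //.
Qed.

(** * Fixed letters of a word *)

Section Words.
Variables (k : nat) (S : {set 'I_k}).
Implicit Types (s t u w : seq 'I_k) (i j : 'I_k) (a : 'I_k -> nat) (T : {set 'I_k}).

Definition below i s := count (fun x : 'I_k => x < i) s.

Lemma below_cat i s t : below i (s ++ t) = below i s + below i t.
Proof. exact: count_cat. Qed.

Lemma below_add_count_mem i j s : j < i -> below j s + count_mem j s <= below i s.
Proof.
move=> ji; elim: s => //= x s IH.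
rewrite /below /= -!/(below _ s).
have -> : (x == j) = (x == j :> nat) by [].
move: IH ji; lia.
Qed.

Lemma below_add_count_mem_size i s : below i s + count_mem i s <= size s.
Proof.
elim: s => //= x s IH; rewrite /below /= -!/(below _ s).
have -> : (x == i) = (x == i :> nat) by [].
move: IH; lia.
Qed.

(** The position encoded by the letter i of the word s ++ i :: t: all the smaller
    blocks come before it, and so do those letters i that stand for smaller
    values (block ascending) or larger values (block descending).  Indices,
    values and positions are counted from 0. *)
Definition position s i t :=
  below i (s ++ t) + (if i \in S then count_mem i t else count_mem i s).

Definition fixed s i t := position s i t == size s.

(** Erasing a fixed i leaves the status of a letter j to its left unchanged.  The
    position of j can drop only if i precedes it as a position (i < j, or i = j in a
    descending block); but then the letter j has a smaller index and a larger
    position than the fixed i, so it is not fixed before and stays not fixed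
    after its position has dropped by one. *)
Lemma fixed_del_after s1 j s2 i t : fixed (s1 ++ j :: s2) i t ->
  fixed s1 j (s2 ++ i :: t) = fixed s1 j (s2 ++ t).
Proof.
rewrite /fixed /position !(below_cat, count_cat, size_cat) /= /below /= -!/(below _ _).
have B u := @below_add_count_mem j i u.
have [->|ji] := eqVneq j i.
  by rewrite !ltnn; case: (boolP (i \in S)) => iS E; lia.
have ij : i == j = false by rewrite eq_sym (negPf ji).
rewrite ?(negPf ji) ?ij => E.
have := (B s1, B s2, B t); have ij' : i != j :> nat by rewrite eq_sym.
case: ltngtP ij' => //= ij' _ [[B1 B2] B3];
case: (boolP (i \in S)) E => iS /eqP E; case: (boolP (j \in S)) => jS; lia.
Qed.

(** The mirror image: the index of j drops by one, and its position does too
    unless j precedes the fixed i as a position, in which case j has a larger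
    index and a smaller position, at distance at least two. *)
Lemma fixed_del_before s i t1 j t2 : fixed s i (t1 ++ j :: t2) ->
  fixed (s ++ i :: t1) j t2 = fixed (s ++ t1) j t2.
Proof.
rewrite /fixed /position !(below_cat, count_cat, size_cat) /= /below /= -!/(below _ _).
have B u := @below_add_count_mem i j u.
have [->|ji] := eqVneq j i.
  by rewrite !ltnn; case: (boolP (i \in S)) => iS E; lia.
have ij : i == j = false by rewrite eq_sym (negPf ji).
rewrite ?(negPf ji) ?ij => E.
have := (B s, B t1, B t2); have ij' : i != j :> nat by rewrite eq_sym.
case: ltngtP ij' => //= ij' _ [[B1 B2] B3];
case: (boolP (i \in S)) E => iS /eqP E; case: (boolP (j \in S)) => jS; lia.
Qed.

(** In a descending block the position decreases as the index increases. *)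
Lemma fixed_desc_unique s1 i s2 t : i \in S -> fixed (s1 ++ i :: s2) i t ->
  ~~ fixed s1 i (s2 ++ i :: t).
Proof.
move=> iS; rewrite /fixed /position !(below_cat, count_cat, size_cat) /= iS eqxx.
by rewrite /below /= -!/(below _ _) !ltnn; lia.
Qed.

(** In an ascending block, between two fixed letters i the index grows by one per
    letter and the position by one per letter i, so all letters in between are
    i, and erasing either end gives the same word. *)
Lemma fixed_del_inj s1 s2 t i :
  fixed s1 i (s2 ++ i :: t) -> fixed (s1 ++ i :: s2) i t ->
  s1 ++ s2 ++ i :: t = s1 ++ i :: s2 ++ t.
Proof.
have [iS|iS] := boolP (i \in S); first by move=> F /(fixed_desc_unique iS)/negP[].
rewrite /fixed /position !(below_cat, count_cat, size_cat) /= (negPf iS) eqxx.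
move=> F1 F2; congr (_ ++ _); apply: all_pred1_cat_cons; rewrite all_count.
move: F1 F2; rewrite /below /= -!/(below _ _) !ltnn; lia.
Qed.

(** Two places that accept a fixed i are separated by letters i only, for the
    reason given for [fixed_del_inj]; in a descending block they coincide. *)
Lemma fixed_ins_inj s1 s2 t i : fixed s1 i (s2 ++ t) -> fixed (s1 ++ s2) i t ->
  s1 ++ s2 ++ i :: t = s1 ++ i :: s2 ++ t.
Proof.
rewrite /fixed /position !(below_cat, count_cat, size_cat) => F1 F2.
congr (_ ++ _); apply: all_pred1_cat_cons; rewrite all_count.
by rewrite /=; move: F1 F2; case: (i \in S) => /=; lia.
Qed.

(** Discrete intermediate value theorem: as the place of insertion m moves from
    left to right, m minus the position encoded by a letter i inserted there
    grows in steps of 0 or 1, from a value <= 0 to a value >= 0. *)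
Lemma fixed_ins_asc i u : i \notin S -> exists s t, u = s ++ t /\ fixed s i t.
Proof.
move=> iS; pose P m := below i u + count_mem i (take m u) <= m.
have exP : exists m, P m.
  by exists (size u); rewrite /P take_size below_add_count_mem_size.
case: (ex_minnP exP) => m Pm minm.
have m_le : m <= size u by apply: minm; rewrite /P take_size below_add_count_mem_size.
exists (take m u), (drop m u); rewrite cat_take_drop; split=> //.
rewrite /fixed /position cat_take_drop (negPf iS) size_takel // eqn_leq.
rewrite (Pm : _ <= _) /=.
case: m m_le minm Pm => // m m_le minm _; rewrite leqNgt ltnS.
apply/negP => lem; suff /minm : P m by rewrite ltnn.
apply: leq_trans lem; rewrite leq_add2l.
by rewrite -addn1 takeD count_cat leq_addr.
Qed.

(** Here the steps are 1 or 2, so the value 0 may be skipped.  It is skipped by a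
    step of 2, across a letter i for which the difference is -1 just to the
    left; that letter is then fixed itself. *)
Lemma fixed_ins_desc i u : i \in S ->
  (forall s t, u = s ++ i :: t -> ~~ fixed s i t) ->
  exists s t, u = s ++ t /\ fixed s i t.
Proof.
move=> iS nofix; pose P m := below i u + count_mem i (drop m u) <= m.
have Pn : P (size u).
  by rewrite /P drop_size /= addn0 count_size.
have exP : exists m, P m by exists (size u).
case: (ex_minnP exP) => m Pm minm.
have m_le : m <= size u by apply: minm.
exists (take m u), (drop m u); rewrite cat_take_drop; split=> //.
rewrite /fixed /position cat_take_drop iS size_takel // eqn_leq.
rewrite (Pm : _ <= _) /=.
case: m m_le minm Pm => // m m_le minm Pm; rewrite leqNgt ltnS.
apply/negP => lem; suff /minm : P m by rewrite ltnn.
move: Pm lem; rewrite /P (drop_nth i m_le) /=.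
have [xi|_] := eqVneq; last by lia.
have uE : u = take m u ++ i :: drop m.+1 u.
  by rewrite -{1}(cat_take_drop m u) (drop_nth i m_le) xi.
have := nofix _ _ uE; rewrite /fixed /position iS size_takel; last exact: ltnW.
have <- : below i u = below i (take m u ++ drop m.+1 u).
  by rewrite {1}uE !below_cat /below /= ltnn.
by move=> neq _ le; rewrite addnCA add1n ltn_neqAle neq.
Qed.

(** A word is read with the part s already behind, so that the condition [fixed]
    on a split of the whole word becomes decidable by recursion. *)
Fixpoint fixfree_from T s w :=
  if w is i :: t then ~~ ((i \in T) && fixed s i t) && fixfree_from T (rcons s i) t
  else true.

Definition fixfree T w := fixfree_from T [::] w.

Lemma fixfree_fromP T r w :
  reflect (forall s i t, w = s ++ i :: t -> i \in T -> ~~ fixed (r ++ s) i t)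
    (fixfree_from T r w).
Proof.
elim: w r => [|j w IH] r /=; first by left=> -[].
apply: (iffP andP) => [[Nj /IH freew] [|x s] i t /=|freew].
- by case=> <- <- jT; move: Nj; rewrite jT cats0.
- by case=> <- wE iT; rewrite -cat_rcons; apply: freew.
split; first by apply/andP => -[jT]; apply/negP; rewrite -[r]cats0; apply: freew.
by apply/IH => s i t wE iT; rewrite cat_rcons; apply: (freew (j :: s) i t); rewrite ?wE.
Qed.

Lemma fixfreeP T w :
  reflect (forall s i t, w = s ++ i :: t -> i \in T -> ~~ fixed s i t) (fixfree T w).
Proof. exact: (fixfree_fromP T [::]). Qed.

Lemma fixfreePn T w : ~~ fixfree T w ->
  exists s i t, [/\ w = s ++ i :: t, i \in T & fixed s i t].
Proof.
suff H r : ~~ fixfree_from T r w ->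
    exists s i t, [/\ w = s ++ i :: t, i \in T & fixed (r ++ s) i t].
  exact: H.
elim: w r => [|j w IH] r //=; rewrite negb_and negbK => /orP[/andP[jT fj]|/IH].
  by exists [::], j, w; rewrite cats0.
case=> s [i [t [-> iT fi]]]; exists (j :: s), i, t; split=> //.
by rewrite -cat_rcons.
Qed.

Lemma fixfree0 w : fixfree set0 w.
Proof. by apply/fixfreeP => s i t _; rewrite inE. Qed.

(** All other letters keep their status, and the erased one, not being in T,
    imposed no condition. *)
Lemma fixfree_del T s i t : i \notin T -> fixed s i t ->
  fixfree T (s ++ i :: t) = fixfree T (s ++ t).
Proof.
move=> iT fi; apply/fixfreeP/fixfreeP => fr s' j t' E jT.
  have [[r [sE tE]]|[r [sE tE]]] := cat_cons_eq_cat E.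
    rewrite tE -(@fixed_del_after _ _ _ i); last by rewrite -sE.
    by apply: fr => //; rewrite sE -catA.
  rewrite sE -(@fixed_del_before _ i); last by rewrite -tE.
  by apply: fr => //; rewrite tE -catA.
have [[r [sE tE]]|[[|x r] [sE tE]]] := cat_cons_eq_cat E.
- rewrite tE (@fixed_del_after _ _ _ i); last by rewrite -sE.
  by apply: fr => //; rewrite sE -catA.
- by case: tE iT => ->; rewrite jT.
rewrite sE; case: tE sE => <- tE sE.
rewrite (@fixed_del_before _ i); last by rewrite -tE.
by apply: fr => //; rewrite tE -catA.
Qed.

Lemma fixfree_desc_del s i t : i \in S -> fixed s i t -> fixfree [set i] (s ++ t).
Proof.
move=> iS fi; apply/fixfreeP => s' j t' E /set1P ji; rewrite {j}ji in E *.
have [[r [sE tE]]|[r [sE tE]]] := cat_cons_eq_cat E.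
  by rewrite tE -(@fixed_del_after _ _ _ i) ?fixed_desc_unique -?sE.
rewrite sE -(@fixed_del_before _ i) -?tE //; apply/negP => /(fixed_desc_unique iS)/negP.
by rewrite -tE.
Qed.

Lemma fixfreeU T1 T2 w : fixfree (T1 :|: T2) w = fixfree T1 w && fixfree T2 w.
Proof.
apply/fixfreeP/andP => [fr|[/fixfreeP fr1 /fixfreeP fr2] s i t E iT].
  by split; apply/fixfreeP => s i t E iT; apply: fr; rewrite // inE iT ?orbT.
by case/setUP: iT; [exact: fr1 | exact: fr2].
Qed.

(** * Words of given content *)

Definition words a := permutations (flatten [seq nseq (a i) i | i <- enum 'I_k]).

Lemma words_uniq a : uniq (words a).
Proof. exact: permutations_uniq. Qed.

Lemma eq_words a a' : a =1 a' -> words a = words a'.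
Proof.
by move=> aa'; congr (permutations (flatten _)); apply: eq_map => i; rewrite aa'.
Qed.

Lemma wordsP a w : reflect (forall i, count_mem i w = a i) (w \in words a).
Proof.
have std i : count_mem i (flatten [seq nseq (a j) j | j <- enum 'I_k]) = a i.
  rewrite count_flatten sumnE !big_map (bigD1 i) //= count_nseq /= eqxx mul1n.
  by rewrite big1 ?addn0 // => j /negPf ji; rewrite count_nseq /= ji.
rewrite mem_permutations; apply: (iffP allP) => [H i|H i _].
  have [iw|/norP[]] :=
      boolP ((i \in w) || (i \in flatten [seq nseq (a j) j | j <- enum 'I_k])).
    by rewrite -std; apply/eqP/H; rewrite mem_cat.
  by move=> /count_memPn-> /count_memPn; rewrite std.
by rewrite /= H std.
Qed.

Definition decr a i : 'I_k -> nat := fun m => a m - (m == i).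

Lemma mem_words_cat_cons a s i t :
  (s ++ i :: t \in words a) = (0 < a i) && (s ++ t \in words (decr a i)).
Proof.
apply/wordsP/andP => [H|[ai /wordsP H] j].
  split; first by rewrite -H count_cat /= eqxx addnCA.
  apply/wordsP => j; rewrite /decr -H !count_cat /= [j == i]eq_sym; lia.
have := H j; rewrite /decr !count_cat /= [j == i]eq_sym.
by have [<-|] := eqVneq; move: ai; lia.
Qed.

Definition fixfree_count T a := count (fixfree T) (words a).

(** The words with no fixed letter in T that do have a fixed i, against the words
    from which a fixed i was erased.  In a descending block i the erased one was
    the only fixed i, so none is left; in an ascending block there may be any
    number of them left. *)
Lemma fixfree_countU1 T a i : i \notin T ->
  fixfree_count T a = fixfree_count (i |: T) a +
    (if 0 < a i then fixfree_count (if i \in S then i |: T else T) (decr a i) else 0).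
Proof.
move=> iT; rewrite /fixfree_count; set T' := (if i \in S then _ else _).
have -> : count (fixfree T) (words a) = count (fixfree (i |: T)) (words a) +
    count (fun w => fixfree T w && ~~ fixfree [set i] w) (words a).
  elim: (words a) => //= w ws ->; rewrite fixfreeU.
  by case: (fixfree T w); case: (fixfree [set i] w) => /=; lia.
congr (_ + _).
have [ai|ai] := ifPn; last first.
  apply/eqP; rewrite -leqn0 leqNgt -has_count; apply/hasPn => w ww.
  rewrite negb_and negbK; apply/orP; right; apply/fixfreeP => s j t wE /set1P ji; move: ww.
  by rewrite wE ji mem_words_cat_cons (negPf ai).
rewrite -!size_filter.
pose R w u := exists s t, [/\ w = s ++ i :: t, u = s ++ t & fixed s i t].
apply: (eq_size_birel (R := R)); rewrite ?filter_uniq ?words_uniq //.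
- move=> w; rewrite mem_filter -andbA => /and3P[frT nfr ww].
  have [s [j [t [wE /set1P ji fi]]]] := fixfreePn nfr; subst j.
  exists (s ++ t); last by exists s, t.
  rewrite wE mem_words_cat_cons ai /= in ww; rewrite mem_filter ww andbT.
  rewrite wE fixfree_del // in frT.
  by rewrite /T'; case: ifP => // iS; rewrite fixfreeU frT fixfree_desc_del.
- move=> u; rewrite mem_filter => /andP[fru wu].
  have [s [t [uE fi]]] : exists s t, u = s ++ t /\ fixed s i t.
    have [iS|iS] := boolP (i \in S); last exact: fixed_ins_asc.
    apply: fixed_ins_desc => // s t uE.
    by move: fru; rewrite /T' iS => /fixfreeP/(_ _ _ _ uE); apply; rewrite setU11.
  exists (s ++ i :: t); last by exists s, t.
  rewrite mem_filter mem_words_cat_cons ai -uE wu !andbT fixfree_del // -uE.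
  apply/andP; split.
    by move: fru; rewrite /T'; case: ifP => _ //; rewrite fixfreeU => /andP[].
  by apply/fixfreeP => /(_ s i t erefl); rewrite set11 fi => /(_ isT).
- move=> w w' u _ _ _ [s [t [-> uE fi]]] [s' [t' [-> uE' fi']]].
  have [] := @cat_eq_cat _ s s' t t'; first by rewrite -uE -uE'.
    by case=> r [sE tE]; subst s' t; rewrite -catA -fixed_ins_inj.
  by case=> r [sE tE]; subst s t'; rewrite -catA -fixed_ins_inj.
move=> w u u' _ _ _ [s [t [wE -> fi]]] [s' [t' [wE' -> fi']]].
have [] := @cat_cons_eq_cat _ s s' (i :: t) i t'; first by rewrite -wE -wE'.
  case=> r [sE tE]; subst s t'; rewrite -catA.
  by rewrite fixed_del_inj.
case=> -[|x r] [sE]; subst s'; rewrite ?cats0; first by case=> ->.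
by case=> xi tE; subst x t; rewrite -catA fixed_del_inj.
Qed.

End Words.

(** * The number of words *)

Section Count.
Variable k : nat.
Implicit Types (s t u w : seq 'I_k) (i j : 'I_k) (a : 'I_k -> nat) (T : {set 'I_k}).

Lemma size_std a : size (flatten [seq nseq (a i) i | i <- enum 'I_k]) = \sum_i a i.
Proof.
rewrite size_flatten /shape sumnE !big_map; apply: eq_bigr => i _; exact: size_nseq.
Qed.

Lemma size_word a w : w \in words a -> size w = \sum_i a i.
Proof. by rewrite mem_permutations => /perm_size ->; apply: size_std. Qed.

Lemma count_head a i :
  count (fun w => ohead w == Some i) (words a) =
  if 0 < a i then size (words (decr a i)) else 0.
Proof.
rewrite -size_filter; case: ifPn => ai; last first.
  apply/eqP; rewrite size_filter -leqn0 leqNgt -has_count; apply/hasPn.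
  case=> [|x w] //= xw.
  apply: contra ai => /eqP[xi]; rewrite {x}xi in xw.
  by have := mem_words_cat_cons a [::] i w; rewrite /= xw => /esym/andP[].
apply: (eq_size_birel (R := fun w u => w = i :: u));
  rewrite ?filter_uniq ?words_uniq //.
- case=> [|x w]; rewrite mem_filter //= => /andP[/eqP[->]].
  by rewrite (mem_words_cat_cons a [::] i w) => /andP[_ ww]; exists w.
- move=> u uw; exists (i :: u) => //; rewrite mem_filter /= eqxx.
  by rewrite (mem_words_cat_cons a [::] i u) ai.
- by move=> w w' u _ _ _ -> ->.
by move=> w u u' _ _ _ -> [].
Qed.

(** By the first letter: the words of content a beginning with i are those of
    content a - e_i, and a_i times the product of the factorials of a - e_i is
    the product of the factorials of a. *)
Lemma size_words a : size (words a) * \prod_i (a i)`! = (\sum_i a i)`!.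
Proof.
have [n] := ubnP (\sum_i a i); elim: n a => // n IH a; rewrite ltnS => an.
have [a0|a_gt0] := posnP (\sum_i a i).
  have {}a0 i : a i = 0 by apply/eqP; rewrite -leqn0 -a0 (bigD1 i) ?leq_addr.
  rewrite !big1 // => [|i _]; last by rewrite a0.
  rewrite muln1 /words; set s := flatten _.
  by have /size0nil-> : size s = 0 by rewrite size_std big1.
have -> : size (words a) = \sum_i count (fun w => ohead w == Some i) (words a).
  rewrite -sum1_size.
  under [RHS]eq_bigr do rewrite -sum1_count big_mkcond.
  rewrite exchange_big /=; apply: eq_big_seq => w /size_word.
  case: w => [/= wa|x w _]; first by rewrite -wa in a_gt0.
  rewrite (bigD1 x) //= eqxx big1 // => j jx.
  by case: eqP => // -[xj]; rewrite xj eqxx in jx.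
rewrite big_distrl /=.
rewrite -(prednK a_gt0) factS prednK // big_distrl /=; apply: eq_bigr => i _.
rewrite count_head; have [ai|] := posnP (a i); first by rewrite ai.
move=> ai.
have sE : (\sum_j a j).-1 = \sum_j decr a i j.
  rewrite (bigD1 i) //= [in RHS](bigD1 i) //= /decr eqxx.
  rewrite [in RHS](eq_bigr a); last by move=> j /negPf->; rewrite subn0.
  by move: ai; lia.
rewrite sE -IH; last by rewrite -sE; move: a_gt0 an; lia.
rewrite (bigD1 i) //= [in RHS](bigD1 i) //= /decr eqxx.
rewrite [in RHS](eq_bigr (fun j => (a j)`!)); last by move=> j /negPf->; rewrite subn0.
rewrite -[in LHS](prednK ai) factS subn1 prednK //=; lia.
Qed.

Lemma fixfree_count0 S a : fixfree_count S set0 a = size (words a).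
Proof.
rewrite -count_predT; apply: eq_count => w; exact: fixfree0.
Qed.

Lemma eq_fixfree_count S T a a' : a =1 a' -> fixfree_count S T a = fixfree_count S T a'.
Proof. by move=> aa'; rewrite /fixfree_count (eq_words aa'). Qed.

Local Open Scope ring_scope.

Lemma eq_multinomial (c c' : 'I_k -> int) : c =1 c' -> multinomial c = multinomial c'.
Proof.
move=> cc'; rewrite /multinomial.
have -> : [forall i, 0 <= c i] = [forall i, 0 <= c' i].
  by apply: eq_forallb => i; rewrite cc'.
case: ifP => // _; rewrite (eq_bigr c') //.
by congr (Posz (_ %/ _)%N); apply: eq_bigr => i _; rewrite cc'.
Qed.

Lemma multinomial_neg (c : 'I_k -> int) i : c i < 0 -> multinomial c = 0.
Proof.
by move=> ci; rewrite /multinomial ifN //; apply/forallPn; exists i; rewrite -ltNge.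
Qed.

Lemma multinomial_nat a : multinomial (fun i => (a i)%:Z) = (size (words a))%:Z.
Proof.
rewrite /multinomial ifT; last by apply/forallP.
rewrite -[X in absz X]/(\sum_i (a i)%:Z)%R -(big_morph Posz PoszD (erefl _)) /=.
rewrite -size_words mulnK //.
by apply: prodn_gt0 => i; apply: fact_gt0.
Qed.

(** * From the recurrence to the alternating sum *)

Definition decrn a i c : 'I_k -> nat := fun m => (a m - (m == i) * c)%N.

(** For an ascending block this is the recurrence itself, with two summands; for a
    descending block the recurrence is unfolded until the letters i run out,
    which is where the bound a_i comes from.  The guard c <= a i discards the
    second summand for an empty ascending block, and agrees with the convention
    that multinomial coefficients with a negative entry vanish. *)
Lemma fixfree_countU1_sum S T a i : i \notin T ->
  (fixfree_count S (i |: T) a)%:Z =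
  \sum_(c < (bmax a S i).+1)
    (-1) ^+ c * (if (c <= a i)%N then (fixfree_count S T (decrn a i c))%:Z else 0).
Proof.
move=> iT; rewrite /bmax; case: ifPn => iS.
  have [n] := ubnP (a i); elim: n a => // n IH a; rewrite ltnS => an.
  have := fixfree_countU1 S a iT; rewrite iS big_ord_recl /= expr0 mul1r.
  rewrite (@eq_fixfree_count _ _ (decrn a i 0) a) => [|m];
    last by rewrite /decrn muln0 subn0.
  have [ai|ai] := posnP (a i); first by rewrite ai big_ord0 addr0 addn0 => ->.
  move=> ->; rewrite PoszD (IH (decr a i));
    last by rewrite /decr eqxx; move: ai an; lia.
  rewrite /decr eqxx subn1 prednK // -/(decr a i).
  rewrite -addrA -[X in X = _]addr0; congr (_ + _).
  rewrite -big_split big1 //= => c _.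
  rewrite /bump add1n exprS mulN1r mulNr.
  have -> : (c <= (a i).-1)%N = (c < a i)%N by move: ai; lia.
  rewrite (@eq_fixfree_count _ _ (decrn (decr a i) i c) (decrn a i c.+1)) ?subrr //.
  by move=> m; rewrite /decrn /decr; case: eqP => _ /=; lia.
rewrite !big_ord_recl big_ord0 /= expr0 expr1 mul1r addr0 mulN1r.
have := fixfree_countU1 S a iT; rewrite (negPf iS) => /(congr1 Posz).
rewrite (@eq_fixfree_count _ _ (decrn a i 0) a) => [|m];
    last by rewrite /decrn muln0 subn0.
rewrite (@eq_fixfree_count _ _ (decrn a i 1) (decr a i)) => [|m];
    last by rewrite /decrn muln1.
by case: ifP => _ ->; rewrite PoszD; ring.
Qed.

(** The bounds l are kept apart from a, and agree with [bmax a S] on T only,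
    because the induction lowers entries of a outside the smaller T while the
    type of the summation index b must not change. *)
Lemma fixfree_count_sum S (l : 'I_k -> nat) T a :
  (forall i, i \in T -> l i = bmax a S i) ->
  (fixfree_count S T a)%:Z =
  \sum_(b : {dffun forall m, 'I_(l m).+1} | [forall (m | m \notin T), b m == ord0])
     (-1) ^+ (\sum_i b i)%N * multinomial (fun i => (a i)%:Z - (b i)%:Z).
Proof.
have [n] := ubnP #|T|; elim: n T a => // n IH T a; rewrite ltnS => cT la.
have [->|[i iT]] := set_0Vmem T.
  pose b0 : {dffun forall m, 'I_(l m).+1} := [ffun m => ord0].
  rewrite (big_pred1 b0) => [|b]; last first.
    apply/forallP/eqP => [b0P|-> m]; last by rewrite ffunE eqxx implybT.
    by apply/ffunP => m; rewrite ffunE; have := b0P m; rewrite inE => /eqP.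
  rewrite big1 => [|m _]; last by rewrite ffunE.
  rewrite expr0 mul1r fixfree_count0 -multinomial_nat; apply: eq_multinomial => m.
  by rewrite ffunE subr0.
have TE : T = i |: T :\ i by rewrite setD1K.
pose Q T' (b : {dffun forall m, 'I_(l m).+1}) :=
  [forall (m | m \notin T'), b m == ord0].
(* The tuples with value c at i are indexed by those with value 0 at i, and the
   latter are the ones over which the sum for T :\ i runs. *)
pose upd (b : {dffun forall m, 'I_(l m).+1}) (c : 'I_(l i).+1) :
   {dffun forall m, 'I_(l m).+1} := [ffun m => dfwith b c m].
have updi b c : upd b c i = c by rewrite ffunE dfwith_in.
have updD b c m : m != i -> upd b c m = b m.
  by move=> mi; rewrite ffunE dfwith_out // eq_sym.
rewrite TE fixfree_countU1_sum ?setD11 // -TE.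
rewrite [RHS](partition_big (fun b : {dffun forall m, 'I_(l m).+1} => b i) predT) //=.
rewrite -(la i iT); apply: eq_bigr => c _.
rewrite (reindex_onto (fun b => upd b c) (fun b => upd b ord0)) /=; last first.
  move=> b /andP[_ /eqP bi]; apply/ffunP => m.
  by have [->|mi] := eqVneq m i; rewrite ?updi ?updD.
have QE b : [forall (m | m \notin T), upd b c m == ord0] && (upd b c i == c) &&
     (upd (upd b c) ord0 == b) = Q (T :\ i) b.
  rewrite updi eqxx andbT; apply/andP/forallP => [[/forallP H /eqP E] m|H]; last split.
  - rewrite !inE negb_and negbK; have := H m; have [->|mi] := eqVneq m i.
      by move=> _; rewrite -E updi eqxx implybT.
    by rewrite updD.
  - apply/forallP => m; apply/implyP => mT; have mi : m != i.
      by apply: contraNneq mT => ->.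
    by have := H m; rewrite !inE (negPf mT) andbF updD.
  apply/eqP/ffunP => m; have [->|mi] := eqVneq m i; last by rewrite !updD.
  by have := H i; rewrite updi !inE eqxx => /eqP.
under eq_bigl do rewrite QE.
have sumE b : Q (T :\ i) b -> (\sum_m upd b c m = c + \sum_m b m)%N.
  move=> /forallP/(_ i); rewrite !inE eqxx /= => /eqP bi.
  rewrite (bigD1 i) //= updi [in RHS](bigD1 i) //= bi add0n; congr (_ + _)%N.
  by apply: eq_bigr => m mi; rewrite updD.
have [ca|ca] := leqP c (a i); last first.
  (* Entry i of every multinomial coefficient is negative. *)
  rewrite mulr0 big1 // => b _; rewrite (multinomial_neg (i := i)) ?mulr0 //.
  by rewrite updi subr_lt0 ltz_nat.
rewrite IH; first last.
- move=> m; rewrite !inE => /andP[mi mT]; rewrite la // /bmax /decrn.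
  by rewrite (negPf mi) mul0n subn0.
- by rewrite (cardsD1 i T) iT in cT.
rewrite big_distrr; apply: eq_bigr => b Qb /=.
rewrite mulrA -exprD sumE //; congr (_ * _); apply: eq_multinomial => m.
rewrite /decrn; have [->|mi] := eqVneq m i; last by rewrite mul0n subn0 updD.
have /forallP/(_ i) := Qb; rewrite !inE eqxx /= updi => /eqP ->.
by rewrite mul1n subr0 subzn.
Qed.

End Count.

(** * Ranks of the letters of a word *)

Section Rank.
Variables (k n : nat) (S : {set 'I_k}).
Implicit Types (f : 'I_n -> 'I_k) (u v : 'I_n).

(** The order of the positions encoded by the word f 0, f 1, ... *)
Definition before f u v :=
  (f u < f v) || (f u == f v) && (if f v \in S then v < u else u < v).

Definition rank f v := #|[set u | before f u v]|.

Lemma before_irr f v : before f v v = false.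
Proof. by rewrite /before !ltnn; case: ifP => _; rewrite andbF. Qed.

Lemma before_trans f v u u' : before f u v -> before f v u' -> before f u u'.
Proof.
rewrite /before => /orP[uv|/andP[/eqP-> uv]] /orP[vu|/andP[/eqP<- vu]];
  rewrite ?uv ?vu //.
  by rewrite (ltn_trans uv vu).
apply/orP; right; rewrite eqxx /=; move: uv vu; case: ifP => _; last exact: ltn_trans.
by move=> ? ?; apply: ltn_trans; first by eassumption.
Qed.

Lemma before_total f u v : u != v -> before f u v || before f v u.
Proof.
move=> uv; rewrite /before; have uv' : u != v :> nat by [].
have -> : (f u == f v) = (f u == f v :> nat) by [].
have -> : (f v == f u) = (f v == f u :> nat) by [].
case: ltngtP => //= /val_inj ->; case: ifP => _; move: uv'; lia.
Qed.

Lemma rank_lt_n f v : rank f v < n.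
Proof.
rewrite -[X in _ < X]card_ord -cardsT; apply: proper_card; rewrite properE subsetT /=.
by apply/subsetPn; exists v; rewrite // inE before_irr.
Qed.

Lemma before_rank_lt f u v : before f u v -> rank f u < rank f v.
Proof.
move=> uv; apply: proper_card; rewrite properE; apply/andP; split.
  by apply/subsetP => x; rewrite !inE => /before_trans; apply.
by apply/subsetPn; exists u; rewrite !inE ?before_irr.
Qed.

Lemma rank_lt f u v : (rank f u < rank f v) = before f u v.
Proof.
apply/idP/idP => [|/before_rank_lt//].
have [->|/(@before_total f)/orP[//|/before_rank_lt vu]] := eqVneq u v.
  by rewrite ltnn.
by rewrite ltnNge (ltnW vu).
Qed.

Lemma rank_inj f : injective (fun v => Ordinal (rank_lt_n f v)).
Proof.
move=> u v [] uv; apply/eqP/negPn/negP => /(@before_total f).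
by rewrite -!rank_lt uv ltnn.
Qed.

Lemma card_count (P : pred 'I_n) : #|[set u | P u]| = count P (enum 'I_n).
Proof. by rewrite cardsE cardE enumT size_filter. Qed.

(** The bridge between two descriptions of a word: a sequence that is split at a
    letter, suited to erasing and inserting, and a function on the indices,
    suited to permutations. *)
Lemma position_rank f v e1 e2 : enum 'I_n = e1 ++ v :: e2 ->
  {in e1, forall u : 'I_n, u < v} -> {in e2, forall u : 'I_n, v < u} ->
  position S (map f e1) (f v) (map f e2) = rank f v.
Proof.
move=> E l1 l2; rewrite /rank card_count E count_cat /= before_irr add0n.
rewrite /position below_cat /below !count_map.
have C e : count (preim f (fun x => x < f v)) e + count (preim f (pred1 (f v))) e =
    count (fun u => (f u < f v) || (f u == f v)) e.
  elim: e => //= u e <-; have -> : (f u == f v) = (f u == f v :> nat) by [].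
  by case: ltngtP => /=; lia.
case: ifP => fv.
  rewrite -addnA C; congr (_ + _); apply: eq_in_count => u ue; rewrite /before fv /=.
    by rewrite [v < u]leqNgt ltnS (ltnW (l1 u ue)) andbF orbF.
  by rewrite l2 // andbT.
rewrite addnAC C; congr (_ + _); apply: eq_in_count => u ue; rewrite /before fv /=.
  by rewrite l1 // andbT.
by rewrite [u < v]leqNgt ltnS (ltnW (l2 u ue)) andbF orbF.
Qed.

Lemma fixfree_rank f :
  fixfree S setT [seq f v | v <- enum 'I_n] = [forall v, rank f v != v].
Proof.
apply/fixfreeP/forallP => [fr v|H s i t E _].
  have [e1 [e2 [E sz l1 l2]]] := enum_ord_split v.
  have := fr (map f e1) (f v) (map f e2); rewrite E map_cat inE => /(_ erefl isT).
  by rewrite /fixed (position_rank f E) // size_map sz.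
have vn : size s < n.
  have /(congr1 size) := E; rewrite size_map size_enum_ord size_cat /=; lia.
have [v vE] : exists v : 'I_n, v = size s :> nat by exists (Ordinal vn).
have [e1 [e2 [E' sz l1 l2]]] := enum_ord_split v.
move: E; rewrite E' map_cat /= => /eqP; rewrite eqseq_cat ?size_map ?sz //.
case/andP => /eqP <- /eqP[<- <-].
by rewrite /fixed (position_rank f E') // size_map sz; apply: H.
Qed.

End Rank.

(** * Blocks *)

Section Blocks.
Variables (k : nat) (a : 'I_k -> nat).
Implicit Types i : 'I_k.

Lemma block_end i : \sum_(m < k | m <= i) a m = \sum_(m < k | m < i) a m + a i.
Proof.
rewrite addnC (bigD1 i) //=; congr (_ + _); apply: eq_bigl => m.
have -> : (m != i) = (m != i :> nat) by [].
by rewrite andbC -ltn_neqAle.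
Qed.

Lemma block_end_le i i' : i < i' ->
  \sum_(m < k | m <= i) a m <= \sum_(m < k | m < i') a m.
Proof.
move=> ii'; rewrite [X in _ <= X](bigID (fun m : 'I_k => m <= i)) /=.
rewrite (eq_bigl (fun m : 'I_k => (m < i') && (m <= i))) ?leq_addr // => m.
by case: (leqP m i) => mi; rewrite ?andbF // (leq_ltn_trans mi).
Qed.

Lemma block_end_total i : \sum_(m < k | m <= i) a m <= Defs.total a.
Proof.
by rewrite /Defs.total [X in _ <= X](bigID (fun m : 'I_k => m <= i)) /= leq_addr.
Qed.

Lemma card_block i : #|block a i| = a i.
Proof.
have lo : \sum_(m < k | m < i) a m <= Defs.total a.
  by apply: leq_trans (block_end_total i); rewrite block_end leq_addr.
have -> : block a i = [set j : 'I_(Defs.total a) | j < \sum_(m < k | m <= i) a m] :\: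
                      [set j : 'I_(Defs.total a) | j < \sum_(m < k | m < i) a m].
  by apply/setP => j; rewrite !inE -leqNgt.
rewrite cardsD (setIidPr _);
  first by rewrite !card_ord_ltn // ?block_end_total // block_end addKn.
by apply/subsetP => j; rewrite !inE block_end => /leq_trans; apply; rewrite leq_addr.
Qed.

Lemma block_lt i i' (j j' : 'I_(Defs.total a)) :
  j \in block a i -> j' \in block a i' -> i < i' -> j < j'.
Proof.
rewrite !inE => /andP[_ ji] /andP[j'i' _] /block_end_le ii'.
exact: leq_trans ji (leq_trans ii' j'i').
Qed.

(** If no block contained j, induction on c would show that the first c blocks end
    at or before j, which fails for c = k. *)
Lemma block_exists (j : 'I_(Defs.total a)) : exists i, j \in block a i.
Proof.
apply/existsP; apply: contraT => /existsPn none.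
suff H c : c <= k -> \sum_(m < k | m < c) a m <= j.
  have := H k (leqnn k); rewrite (eq_bigl predT) => [|m]; last exact: ltn_ord.
  by rewrite leqNgt ltn_ord.
elim: c => [|c IH] ck; first by rewrite big_pred0.
by have := none (Ordinal ck); rewrite inE IH ?(ltnW ck) //= -leqNgt.
Qed.

Lemma block_fun :
  exists blk : 'I_(Defs.total a) -> 'I_k, forall i j, (j \in block a i) = (blk j == i).
Proof.
have [blk blkP] := fin_all_exists block_exists; exists blk => i j.
apply/idP/eqP => [ji|<-]; last exact: blkP.
apply: val_inj; have := blkP j; case: (ltngtP (blk j) i) => // lt jb.
  by have := block_lt jb ji lt; rewrite ltnn.
by have := block_lt ji jb lt; rewrite ltnn.
Qed.

End Blocks.

(** * Blockwise monotone permutations and their words *)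

Section PermWords.
Variables (k : nat) (a : 'I_k -> nat) (S : {set 'I_k}).
Variable blk : 'I_(Defs.total a) -> 'I_k.
Hypothesis blkE : forall i j, (j \in block a i) = (blk j == i).
Implicit Types (p : 'S_(Defs.total a)) (j v : 'I_(Defs.total a)).

Definition letters p v := blk ((p^-1)%g v).

Lemma blk_homo j j' : j < j' -> blk j <= blk j'.
Proof.
apply: contraTT; rewrite -!leqNgt -ltnNge => lt.
by apply: ltnW; apply: block_lt lt; rewrite blkE.
Qed.

Lemma blockwise_monotone_lt p j j' :
  blockwise_monotone S p -> blk j = blk j' -> j < j' ->
  if blk j' \in S then p j' < p j else p j < p j'.
Proof.
move=> mono; have [d] := ubnP (j' - j); elim: d j' => // d IH j' dj jj' lt.
have step j1 : j' = j1.+1 :> nat -> blk j1 = blk j' ->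
    if blk j' \in S then p j' < p j1 else p j1 < p j'.
  move=> j1j' bb; move/forallP/(_ (blk j')): mono.
  move=> /forall_inP/(_ j1); rewrite blkE bb eqxx => /(_ isT).
  by move=> /forall_inP/(_ j'); rewrite blkE eqxx => /(_ isT) /implyP; apply; apply/eqP.
have j1P : j'.-1 < Defs.total a by apply: leq_ltn_trans (leq_pred _) (ltn_ord j').
pose j1 := Ordinal j1P.
have j'E : j' = j1.+1 :> nat by rewrite /= prednK // (leq_ltn_trans _ lt).
have [jj1|jj1] := eqVneq j j1; first by rewrite jj1; apply: step; rewrite // -jj1.
have lt1 : j < j1 by rewrite ltn_neqAle jj1 -ltnS -j'E.
have bj1 : blk j = blk j1.
  apply: val_inj; apply/eqP; rewrite eqn_leq blk_homo // jj' blk_homo // j'E //.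
have := step j1 j'E; rewrite -bj1 jj' => /(_ erefl).
have := IH j1; rewrite -bj1 jj' => /(_ _ erefl lt1); case: ifP => _ H1 H2.
  by apply: ltn_trans H2 (H1 _); move: dj; rewrite j'E; lia.
by apply: ltn_trans (H1 _) H2; move: dj; rewrite j'E; lia.
Qed.

(** This is why the word determines p: the blocks follow each other and p is
    monotone on each, so comparing letters first and values second amounts to
    comparing positions. *)
Lemma before_letters p u v : blockwise_monotone S p ->
  before S (letters p) u v = ((p^-1)%g u < (p^-1)%g v).
Proof.
move=> mono.
have H j j' : j < j' -> before S (letters p) (p j) (p j').
  move=> lt; rewrite /before /letters !permK.
  have := blk_homo lt; rewrite leq_eqVlt => /predU1P[/val_inj bb|-> //].
  by apply/orP; right; rewrite bb eqxx; apply: blockwise_monotone_lt.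
apply/idP/idP => [|lt]; last by have := H _ _ lt; rewrite !permKV.
apply: contraLR; rewrite -leqNgt leq_eqVlt => /predU1P[/val_inj/perm_inj->|/H].
  by rewrite before_irr.
by rewrite !permKV -!rank_lt => /ltnW; rewrite -leqNgt.
Qed.

Lemma rank_letters p v : blockwise_monotone S p -> rank S (letters p) v = (p^-1)%g v.
Proof.
move=> mono; rewrite /rank; have -> : [set u | before S (letters p) u v] =
    p @: [set j : 'I_(Defs.total a) | j < (p^-1)%g v].
  apply/setP => u; rewrite inE before_letters //; apply/idP/imsetP => [lt|[j]].
    by exists ((p^-1)%g u); rewrite ?inE ?permKV.
  by rewrite inE => lt ->; rewrite permK.
by rewrite card_imset ?card_ord_ltn //; [exact: ltnW | exact: perm_inj].
Qed.

Lemma derangement_letters p : blockwise_monotone S p ->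
  derangement p = fixfree S setT [seq letters p v | v <- enum 'I_(Defs.total a)].
Proof.
move=> mono; rewrite fixfree_rank /derangement; apply: eq_forallb => v.
rewrite rank_letters //.
have -> : ((p^-1)%g v != v :> nat) = ((p^-1)%g v != v) by [].
by rewrite -[in RHS](inj_eq (@perm_inj _ p)) permKV eq_sym.
Qed.

Lemma letters_words p : [seq letters p v | v <- enum 'I_(Defs.total a)] \in words a.
Proof.
apply/wordsP => i; rewrite count_map -card_count -(card_block a i).
rewrite -(card_imset _ (@perm_inj _ p)); apply: eq_card => u.
rewrite inE /=; apply/idP/imsetP => [bi|[j]];
  last by rewrite blkE => bi ->; rewrite /letters permK.
by exists ((p^-1)%g u); rewrite ?permKV // blkE.
Qed.

(** The permutation is recovered by sending each index to its rank.  The rank of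
    v falls into block f v, since exactly the smaller letters fill the smaller
    blocks. *)
Lemma letters_surj (f : 'I_(Defs.total a) -> 'I_k) :
  (forall i, #|[set u | f u == i]| = a i) ->
  exists2 p, blockwise_monotone S p & letters p =1 f.
Proof.
move=> fa.
have card_below (P : pred 'I_k) : #|[set u | P (f u)]| = \sum_(m < k | P m) a m.
  rewrite -sum1_card (partition_big f P) => [|u]; last by rewrite inE.
  apply: eq_bigr => i Pi; rewrite -fa -sum1_card; apply: eq_bigl => u; rewrite !inE.
  by case: eqP => [->|]; rewrite ?Pi ?andbF.
pose p := ((perm (@rank_inj _ _ S f))^-1)%g.
have pV v : (p^-1)%g v = rank S f v :> nat by rewrite invgK permE.
have pf : letters p =1 f.
  move=> v; apply/eqP; rewrite -blkE inE pV -!card_below; apply/andP; split.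
    by apply/subset_leq_card/subsetP => u; rewrite !inE /before => ->.
  apply/proper_card/properP; split.
    apply/subsetP => u; rewrite !inE /before => /orP[/ltnW//|/andP[/eqP->]].
    by rewrite leqnn.
  by exists v; rewrite inE ?leqnn ?before_irr.
exists p => //; apply/forallP => i; apply/forall_inP => j ji.
apply/forall_inP => j' j'i; apply/implyP => /eqP jj'.
have : before S f (p j) (p j') by rewrite -rank_lt -!pV !permK jj'.
move: ji j'i; rewrite /before -!pf /letters !permK !blkE => /eqP-> /eqP->.
by rewrite ltnn eqxx.
Qed.

End PermWords.

(** Reading off the word is injective because the inverse permutation is the rank,
    and by the same token fixed points become fixed letters. *)
Lemma card_aS_derangements k (a : 'I_k -> nat) (S : {set 'I_k}) :
  #|aS_derangements a S| = fixfree_count S setT a.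
Proof.
have [blk blkE] := block_fun a.
rewrite cardE /fixfree_count -size_filter.
pose R p w := w = [seq letters blk p v | v <- enum 'I_(Defs.total a)].
apply: (eq_size_birel (R := R)).
- exact: enum_uniq.
- by rewrite filter_uniq ?words_uniq.
- move=> p; rewrite mem_enum inE => /andP[mono der]; eexists; last by [].
  by rewrite mem_filter letters_words // andbT -derangement_letters.
- move=> w; rewrite mem_filter => /andP[fr ww].
  have sz : size w == Defs.total a by rewrite (size_word ww).
  pose f := tnth (Tuple sz).
  have wE : [seq f v | v <- enum 'I_(Defs.total a)] = w by rewrite map_tnth_enum.
  have [i|p mono pf] := letters_surj S blkE (f := f).
    by rewrite card_count -(wordsP _ _ ww i) -[in RHS]wE count_map.
  have wE' : w = [seq letters blk p v | v <- enum 'I_(Defs.total a)].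
    by rewrite -[LHS]wE; apply: eq_map => v; rewrite pf.
  exists p => //; rewrite mem_enum inE mono /=.
  by rewrite (derangement_letters blkE mono) -wE'.
- move=> p p' w; rewrite !mem_enum !inE => /andP[mono _] /andP[mono' _] _ -> E.
  move/eq_in_map: E => E.
  apply: invg_inj; apply/permP => v; apply: val_inj => /=.
  rewrite -(rank_letters blkE _ mono) -(rank_letters blkE _ mono').
  have {}E u : letters blk p u = letters blk p' u by apply: E; rewrite mem_enum.
  by apply: eq_card => u; rewrite !inE /before !E.
by move=> p w w' _ _ _ -> ->.
Qed.

Local Open Scope ring_scope.

Theorem theorem3p2 (k : nat) (hk : (1 <= k)%N) (a : 'I_k -> nat)
    (S : {set 'I_k}) :
  (#|aS_derangements a S|)%:Z =
  \sum_(b : {dffun forall m : 'I_k, 'I_(bmax a S m).+1})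
     (-1) ^+ (\sum_i b i)%N * multinomial (fun i => (a i)%:Z - (b i)%:Z).
Proof.
rewrite card_aS_derangements (fixfree_count_sum (l := bmax a S)) //.
by apply: eq_bigl => b; apply/forallP => m; rewrite inE.
Qed.
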